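(* The category $\mathbf{Reg}$ is cartesian closed, and the forgetful functor $p:\mathbf{Reg}\to\mathbf{Lam}$, $(A,L)\mapsto A$, is a cartesian closed fibration: it is a Grothendieck fibration and it strictly preserves finite products and internal homs.
   Context: Simple types are generated by $A,B::=A\times B\mid A\Rightarrow B\mid 1\mid o$ with one base type $o$. $\mathrm{Tm}(A)$ is the set of closed simply-typed $\lambda$-terms (with pairs, projections and unit) of type $A$ modulo $\beta\eta$-conversion. $\mathbf{Lam}$ is the free cartesian closed category on one object $o$: its objects are simple types and its morphisms $A\to B$ are closed $\lambda$-terms of type $A\Rightarrow B$ modulo $\beta\eta$ (composition of $M:A\to B$ and $N:B\to C$ is $\lambda x.N(Mx)$). For a finite set $Q$, $[\![-]\!]_Q$ is the standard interpretation in finite sets with $[\![o]\!]_Q=Q$. A language $L\subseteq\mathrm{Tm}(A)$ is $Q$-regular if $L=\{M\in\mathrm{Tm}(A)\mid[\![M]\!]_Q\in F\}$ for some $F\subseteq[\![A]\!]_Q$, and regular if it is $Q$-regular for some finite set $Q$. The category $\mathbf{Reg}$ has objects the pairs $(A,L)$ with $A$ a simple type and $L\subseteq\mathrm{Tm}(A)$ regular, and morphisms $(A,L_A)\to(B,L_B)$ the morphisms $M:A\to B$ of $\mathbf{Lam}$ such that for all $P\in\mathrm{Tm}(A)$, $P\in L_A$ implies $MP\in L_B$. A functor $p:\mathcal E\to\mathcal B$ is a fibration if for every morphism $f:X\to Y$ in $\mathcal B$ and every object $V$ with $p(V)=Y$ there is a cartesian lifting of $f$ with codomain $V$. *)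

(* Defs.v *)
From HB Require Import structures.
From Stdlib Require Import Setoid Morphisms.
From mathcomp Require Import all_boot.
From mathcomp Require Import boolp classical_sets.

Set Implicit Arguments.
Unset Strict Implicit.
Unset Printing Implicit Defensive.

Local Open Scope classical_set_scope.
Local Open Scope quotient_scope.

Record category := Category {
  obj :> Type;
  hom : obj -> obj -> Type;
  idm : forall X, hom X X;
  compm : forall X Y Z, hom Y Z -> hom X Y -> hom X Z;
  compm1l : forall X Y (f : hom X Y), compm (idm Y) f = f;
  compm1r : forall X Y (f : hom X Y), compm f (idm X) = f;
  compmA : forall X Y Z W (h : hom Z W) (g : hom Y Z) (f : hom X Y),
    compm h (compm g f) = compm (compm h g) f }.

Arguments hom {c}.
Arguments idm {c}.
Arguments compm {c X Y Z}.

Record functor (E B : category) := Functor {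
  fobj :> E -> B;
  fhom : forall X Y, hom X Y -> hom (fobj X) (fobj Y);
  fhom_id : forall X, fhom (idm X) = idm (fobj X);
  fhom_comp : forall X Y Z (g : hom Y Z) (f : hom X Y),
    fhom (compm g f) = compm (fhom g) (fhom f) }.

Arguments fhom {E B} _ {X Y} _.

(* A morphism packed with its domain and codomain: [arr f = arr g] is the
   equality of two morphisms whose endpoints are equal but not necessarily
   convertible. *)
Definition arrow (C : category) := {XY : C * C & hom XY.1 XY.2}.

Definition arr (C : category) (X Y : C) (f : hom X Y) : arrow C :=
  existT (fun XY : C * C => hom XY.1 XY.2) (X, Y) f.

(* Chosen finite products (terminal object, binary products) and chosen
   exponentials; [expo X Y] is the internal hom from X to Y. *)
Record cartesian_closed (C : category) := CartesianClosed {
  unito : C;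
  bang : forall X, hom X unito;
  bang_uniq : forall X (f : hom X unito), f = bang X;
  prodo : C -> C -> C;
  proj1 : forall X Y, hom (prodo X Y) X;
  proj2 : forall X Y, hom (prodo X Y) Y;
  pairm : forall Z X Y, hom Z X -> hom Z Y -> hom Z (prodo X Y);
  pairm1 : forall Z X Y (f : hom Z X) (g : hom Z Y),
    compm (proj1 X Y) (pairm f g) = f;
  pairm2 : forall Z X Y (f : hom Z X) (g : hom Z Y),
    compm (proj2 X Y) (pairm f g) = g;
  pairm_uniq : forall Z X Y (h : hom Z (prodo X Y)),
    h = pairm (compm (proj1 X Y) h) (compm (proj2 X Y) h);
  expo : C -> C -> C;
  evalm : forall X Y, hom (prodo (expo X Y) X) Y;
  currym : forall Z X Y, hom (prodo Z X) Y -> hom Z (expo X Y);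
  currymK : forall Z X Y (f : hom (prodo Z X) Y),
    compm (evalm X Y) (pairm (compm (currym f) (proj1 Z X)) (proj2 Z X)) = f;
  currym_uniq : forall Z X Y (g : hom Z (expo X Y)),
    g = currym (compm (evalm X Y)
                  (pairm (compm g (proj1 Z X)) (proj2 Z X))) }.

Definition strictly_preserves_finite_products (E B : category)
    (KE : cartesian_closed E) (KB : cartesian_closed B) (p : functor E B) :=
  [/\ p (unito KE) = unito KB,
      forall X Y, p (prodo KE X Y) = prodo KB (p X) (p Y),
      forall X Y, arr (fhom p (proj1 KE X Y)) = arr (proj1 KB (p X) (p Y)) &
      forall X Y, arr (fhom p (proj2 KE X Y)) = arr (proj2 KB (p X) (p Y))].

Definition strictly_preserves_internal_homs (E B : category)
    (KE : cartesian_closed E) (KB : cartesian_closed B) (p : functor E B) :=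
  (forall X Y, p (expo KE X Y) = expo KB (p X) (p Y)) /\
  (forall X Y, arr (fhom p (evalm KE X Y)) = arr (evalm KB (p X) (p Y))).

Definition cartesian (E B : category) (p : functor E B) (U V : E)
    (g : hom U V) :=
  forall (W : E) (h : hom W V) (w : hom (p W) (p U)),
    compm (fhom p g) w = fhom p h ->
    exists! k : hom W U, fhom p k = w /\ compm g k = h.

Definition fibration (E B : category) (p : functor E B) :=
  forall (X Y : B) (f : hom X Y) (V : E), p V = Y ->
    exists (U : E) (g : hom U V), arr (fhom p g) = arr f /\ cartesian p g.

Inductive ty := Prod (A B : ty) | Arrow (A B : ty) | One | Base.

(* Intrinsically typed terms with de Bruijn variables. *)
Inductive var : seq ty -> ty -> Type :=
| vz G A : var (A :: G) A
| vs G A B : var G A -> var (B :: G) A.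

Arguments vz {G A}.
Arguments vs {G A B}.

Inductive tm (G : seq ty) : ty -> Type :=
| tvar A : var G A -> tm G A
| tlam A B : tm (A :: G) B -> tm G (Arrow A B)
| tapp A B : tm G (Arrow A B) -> tm G A -> tm G B
| tpair A B : tm G A -> tm G B -> tm G (Prod A B)
| tfst A B : tm G (Prod A B) -> tm G A
| tsnd A B : tm G (Prod A B) -> tm G B
| tunit : tm G One.

Arguments tunit {G}.

(* Families indexed by the variables of the empty, resp. of an extended,
   context. *)
Definition vnil (T : ty -> Type) A (v : var [::] A) : T A :=
  match v in var G A' return (if G is [::] then T A' else unit) with
  | vz _ _ => tt
  | vs _ _ _ _ => tt
  end.

Definition scons (T : ty -> Type) G B (x : T B) (s : forall A, var G A -> T A)
    A (v : var (B :: G) A) : T A :=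
  match v in var G' A' return
    (if G' is B' :: G0 then T B' -> (forall A, var G0 A -> T A) -> T A'
     else unit) with
  | vz _ _ => fun x _ => x
  | vs _ _ _ v => fun _ s => s _ v
  end x s.

Definition vren G D := forall A, var G A -> var D A.
Definition vsub G D := forall A, var G A -> tm D A.

Definition upr G D B (r : vren G D) : vren (B :: G) (B :: D) :=
  scons (T := var (B :: D)) vz (fun A v => vs (r A v)).

Fixpoint ren G A (t : tm G A) : forall D, vren G D -> tm D A :=
  match t with
  | tvar _ v => fun D r => tvar (r _ v)
  | tlam _ _ t => fun D r => tlam (ren t (upr r))
  | tapp _ _ t u => fun D r => tapp (ren t r) (ren u r)
  | tpair _ _ t u => fun D r => tpair (ren t r) (ren u r)
  | tfst _ _ t => fun D r => tfst (ren t r)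
  | tsnd _ _ t => fun D r => tsnd (ren t r)
  | tunit => fun D r => tunit
  end.

Definition shift G B A (t : tm G A) : tm (B :: G) A := ren t (fun _ v => vs v).

Definition ups G D B (s : vsub G D) : vsub (B :: G) (B :: D) :=
  scons (T := tm (B :: D)) (tvar vz) (fun A v => shift B (s A v)).

Fixpoint sub G A (t : tm G A) : forall D, vsub G D -> tm D A :=
  match t with
  | tvar _ v => fun D s => s _ v
  | tlam _ _ t => fun D s => tlam (sub t (ups s))
  | tapp _ _ t u => fun D s => tapp (sub t s) (sub u s)
  | tpair _ _ t u => fun D s => tpair (sub t s) (sub u s)
  | tfst _ _ t => fun D s => tfst (sub t s)
  | tsnd _ _ t => fun D s => tsnd (sub t s)
  | tunit => fun D s => tunit
  end.

Definition sub1 G A B (t : tm (B :: G) A) (u : tm G B) : tm G A :=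
  sub t (scons (T := tm G) u (fun A v => tvar v)).

Inductive conv : forall G A, tm G A -> tm G A -> Prop :=
| conv_refl G A (t : tm G A) : conv t t
| conv_sym G A (t u : tm G A) : conv t u -> conv u t
| conv_trans G A (t u v : tm G A) : conv t u -> conv u v -> conv t v
| conv_lam G A B (t t' : tm (A :: G) B) : conv t t' -> conv (tlam t) (tlam t')
| conv_app G A B (t t' : tm G (Arrow A B)) (u u' : tm G A) :
    conv t t' -> conv u u' -> conv (tapp t u) (tapp t' u')
| conv_pair G A B (t t' : tm G A) (u u' : tm G B) :
    conv t t' -> conv u u' -> conv (tpair t u) (tpair t' u')
| conv_fst G A B (t t' : tm G (Prod A B)) : conv t t' -> conv (tfst t) (tfst t')
| conv_snd G A B (t t' : tm G (Prod A B)) : conv t t' -> conv (tsnd t) (tsnd t')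
| conv_beta G A B (t : tm (A :: G) B) (u : tm G A) :
    conv (tapp (tlam t) u) (sub1 t u)
| conv_eta G A B (t : tm G (Arrow A B)) :
    conv t (tlam (tapp (shift A t) (tvar vz)))
| conv_beta_fst G A B (t : tm G A) (u : tm G B) : conv (tfst (tpair t u)) t
| conv_beta_snd G A B (t : tm G A) (u : tm G B) : conv (tsnd (tpair t u)) u
| conv_eta_pair G A B (t : tm G (Prod A B)) : conv t (tpair (tfst t) (tsnd t))
| conv_eta_unit G (t : tm G One) : conv t tunit.

#[export] Hint Resolve conv_refl : core.

Definition convb G A (t u : tm G A) : bool := `[< conv t u >].

Lemma convb_equiv G A : equiv_class_of (@convb G A).
Proof.
split=> [t|t u|u t v].
- exact/asboolP/conv_refl.
- by apply/asboolP/asboolP; apply: conv_sym.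
- by move=> /asboolP tu /asboolP uv; apply/asboolP/(conv_trans tu uv).
Qed.

Canonical convb_equiv_rel G A := EquivRelPack (@convb_equiv G A).

HB.instance Definition _ G A := gen_eqMixin (tm G A).
HB.instance Definition _ G A := gen_choiceMixin (tm G A).

Definition Tm (A : ty) : Type := {eq_quot (@convb [::] A)}.

Definition cls A (t : tm [::] A) : Tm A := \pi_({eq_quot (@convb [::] A)}) t.
Definition rep A (M : Tm A) : tm [::] A :=
  @repr _ ({eq_quot (@convb [::] A)}) M.

Lemma repK A (M : Tm A) : cls (rep M) = M.
Proof. exact: reprK. Qed.

Lemma cls_eq A (t u : tm [::] A) : cls t = cls u <-> conv t u.
Proof.
split; first by move=> /eqmodP/asboolP.
by move=> tu; apply/eqmodP/asboolP.
Qed.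

Lemma rep_cls A (t : tm [::] A) : conv (rep (cls t)) t.
Proof. by apply/cls_eq; rewrite repK. Qed.

Lemma clsP A (P : Tm A -> Prop) : (forall t, P (cls t)) -> forall M, P M.
Proof. by move=> Pc M; rewrite -(repK M). Qed.

#[export] Instance conv_equivalence G A : Equivalence (@conv G A).
Proof.
split; [exact: conv_refl | exact: conv_sym | exact: conv_trans].
Qed.

#[export] Instance tlam_proper G A B :
  Proper (@conv (A :: G) B ==> @conv G _) (@tlam G A B).
Proof. by move=> t t'; exact: conv_lam. Qed.

#[export] Instance tapp_proper G A B :
  Proper (@conv G (Arrow A B) ==> @conv G A ==> @conv G B) (@tapp G A B).
Proof. by move=> t t' tt' u u'; exact: conv_app. Qed.

#[export] Instance tpair_proper G A B :
  Proper (@conv G A ==> @conv G B ==> @conv G _) (@tpair G A B).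
Proof. by move=> t t' tt' u u'; exact: conv_pair. Qed.

#[export] Instance tfst_proper G A B :
  Proper (@conv G (Prod A B) ==> @conv G A) (@tfst G A B).
Proof. by move=> t t'; exact: conv_fst. Qed.

#[export] Instance tsnd_proper G A B :
  Proper (@conv G (Prod A B) ==> @conv G B) (@tsnd G A B).
Proof. by move=> t t'; exact: conv_snd. Qed.

Lemma var_cons G B (P : forall A, var (B :: G) A -> Prop) :
  P B vz -> (forall A (v : var G A), P A (vs v)) -> forall A v, P A v.
Proof.
move=> Pz Ps A v; move: P Pz Ps.
refine (match v as v0 in var G' A' return
  (if G' is B' :: G0 return var G' A' -> Prop then fun v0 =>
     forall P : forall A, var (B' :: G0) A -> Prop,
     P B' vz -> (forall A (v : var G0 A), P A (vs v)) -> P A' v0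
   else fun _ => True) v0 with vz _ _ => _ | vs _ _ _ _ => _ end); by [].
Qed.

Lemma var_nil (P : forall A, var [::] A -> Prop) : forall A v, P A v.
Proof.
move=> A v.
refine (match v as v0 in var G' A' return
  (if G' is [::] return var G' A' -> Prop
   then fun v0 => forall P : forall A, var [::] A -> Prop, P A' v0
   else fun _ => True) v0
  with vz _ _ => I | vs _ _ _ _ => I end P).
Qed.

Lemma ren_ext G A (t : tm G A) D (r r' : vren G D) :
  (forall A v, r A v = r' A v) -> ren t r = ren t r'.
Proof.
elim: t D r r' => {G A} [G A v|G A B t IH|G A B t IH u IHu|G A B t IH u IHu
  |G A B t IH|G A B t IH|G] D r r' rr' //=; rewrite ?(IH _ _ r') ?(IHu _ _ r') //.
- by rewrite rr'.
- rewrite (IH _ _ (upr r')) //; apply: var_cons => //= C v.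
  by rewrite /upr /= rr'.
Qed.

Lemma sub_ext G A (t : tm G A) D (s s' : vsub G D) :
  (forall A v, s A v = s' A v) -> sub t s = sub t s'.
Proof.
elim: t D s s' => {G A} [G A v|G A B t IH|G A B t IH u IHu|G A B t IH u IHu
  |G A B t IH|G A B t IH|G] D s s' ss' //=; rewrite ?(IH _ _ s') ?(IHu _ _ s') //.
rewrite (IH _ _ (ups s')) //; apply: var_cons => //= C v.
by rewrite /ups /= ss'.
Qed.

Lemma ren_ren G A (t : tm G A) D E (r : vren G D) (r' : vren D E) :
  ren (ren t r) r' = ren t (fun A v => r' A (r A v)).
Proof.
elim: t D E r r' => {G A} [G A v|G A B t IH|G A B t IH u IHu|G A B t IH u IHu
  |G A B t IH|G A B t IH|G] D E r r' //=; rewrite ?IH ?IHu //.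
by congr tlam; apply: ren_ext; apply: var_cons.
Qed.

Lemma sub_ren G A (t : tm G A) D E (r : vren G D) (s : vsub D E) :
  sub (ren t r) s = sub t (fun A v => s A (r A v)).
Proof.
elim: t D E r s => {G A} [G A v|G A B t IH|G A B t IH u IHu|G A B t IH u IHu
  |G A B t IH|G A B t IH|G] D E r s //=; rewrite ?IH ?IHu //.
by congr tlam; apply: sub_ext; apply: var_cons.
Qed.

Lemma ren_sub G A (t : tm G A) D E (s : vsub G D) (r : vren D E) :
  ren (sub t s) r = sub t (fun A v => ren (s A v) r).
Proof.
elim: t D E s r => {G A} [G A v|G A B t IH|G A B t IH u IHu|G A B t IH u IHu
  |G A B t IH|G A B t IH|G] D E s r //=; rewrite ?IH ?IHu //.
congr tlam; apply: sub_ext; apply: var_cons => //= C v.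
by rewrite /ups /= /shift !ren_ren.
Qed.

Lemma sub_id G A (t : tm G A) : sub t (fun A v => tvar v) = t.
Proof.
elim: t => {G A} [G A v|G A B t IH|G A B t IH u IHu|G A B t IH u IHu
  |G A B t IH|G A B t IH|G] //=; rewrite ?IH ?IHu //.
congr tlam; rewrite -[RHS]IH; apply: sub_ext; exact: var_cons.
Qed.

Lemma ren_id G A (t : tm G A) : ren t (fun A v => v) = t.
Proof.
elim: t => {G A} [G A v|G A B t IH|G A B t IH u IHu|G A B t IH u IHu
  |G A B t IH|G A B t IH|G] //=; rewrite ?IH ?IHu //.
congr tlam; rewrite -[RHS]IH; apply: ren_ext; exact: var_cons.
Qed.

Lemma conv_ren G A (t u : tm G A) D (r : vren G D) :
  conv t u -> conv (ren t r) (ren u r).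
Proof.
move=> tu; elim: tu D r => {G A t u} /=.
- by move=> *; exact: conv_refl.
- by move=> G A t u _ IH D r; apply: conv_sym.
- by move=> G A t u v _ IH1 _ IH2 D r; apply: conv_trans (IH1 D r) (IH2 D r).
- by move=> *; apply: conv_lam.
- by move=> *; apply: conv_app.
- by move=> *; apply: conv_pair.
- by move=> *; apply: conv_fst.
- by move=> *; apply: conv_snd.
- move=> G A B t u D r.
  have -> : ren (sub1 t u) r = sub1 (ren t (upr r)) (ren u r).
    rewrite /sub1 ren_sub sub_ren; apply: sub_ext; exact: var_cons.
  exact: conv_beta.
- move=> G A B t D r.
  have -> : ren (shift A t) (upr r) = shift A (ren t r).
    by rewrite /shift !ren_ren.
  exact: conv_eta.
- by move=> *; apply: conv_beta_fst.
- by move=> *; apply: conv_beta_snd.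
- by move=> *; apply: conv_eta_pair.
- by move=> *; apply: conv_eta_unit.
Qed.

Definition wk G A (t : tm [::] A) : tm G A := ren t (@vnil (var G)).
Arguments wk G {A} t : simpl never.

#[export] Instance wk_proper G A : Proper (@conv [::] A ==> @conv G A) (@wk G A).
Proof. by move=> t u; exact: conv_ren. Qed.

Lemma ren_wk G D A (t : tm [::] A) (r : vren G D) : ren (wk G t) r = wk D t.
Proof. by rewrite /wk ren_ren; apply: ren_ext; exact: var_nil. Qed.

Lemma sub_wk G D A (t : tm [::] A) (s : vsub G D) : sub (wk G t) s = wk D t.
Proof.
rewrite /wk sub_ren -[RHS]sub_id sub_ren; apply: sub_ext; exact: var_nil.
Qed.

Lemma wk_nil A (t : tm [::] A) : wk [::] t = t.
Proof. by rewrite -[RHS]ren_id /wk; apply: ren_ext; exact: var_nil. Qed.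

Lemma wk_beta G A B (t : tm [:: A] B) (u : tm G A) :
  conv (tapp (wk G (tlam t)) u) (sub t (scons (T := tm G) u (@vnil (tm G)))).
Proof.
have <- : sub1 (ren t (upr (@vnil (var G)))) u
          = sub t (scons (T := tm G) u (@vnil (tm G))).
  rewrite /sub1 sub_ren; apply: sub_ext; apply: var_cons => //.
  exact: var_nil.
exact: conv_beta.
Qed.

Definition compt A B C (u : tm [::] (Arrow B C)) (t : tm [::] (Arrow A B)) :
    tm [::] (Arrow A C) :=
  tlam (tapp (wk [:: A] u) (tapp (wk [:: A] t) (tvar vz))).

#[export] Instance compt_proper A B C :
  Proper (@conv _ (Arrow B C) ==> @conv _ (Arrow A B) ==> @conv _ (Arrow A C))
    (@compt A B C).
Proof. by move=> u u' uu' t t' tt'; rewrite /compt uu' tt'. Qed.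

Lemma wk_compt G A B C (u : tm [::] (Arrow B C)) (t : tm [::] (Arrow A B))
    (x : tm G A) :
  conv (tapp (wk G (compt u t)) x) (tapp (wk G u) (tapp (wk G t) x)).
Proof. by rewrite wk_beta /= !sub_wk; exact: conv_refl. Qed.

Lemma compt_app A B C (u : tm [::] (Arrow B C)) (t : tm [::] (Arrow A B))
    (x : tm [::] A) :
  conv (tapp (compt u t) x) (tapp u (tapp t x)).
Proof. by have := wk_compt u t x; rewrite !wk_nil. Qed.

Lemma conv_fun A B (t u : tm [::] (Arrow A B)) :
  conv (tapp (wk [:: A] t) (tvar vz)) (tapp (wk [:: A] u) (tvar vz)) ->
  conv t u.
Proof.
have E (v : tm [::] (Arrow A B)) : shift A v = wk [:: A] v.
  by rewrite -{1}(wk_nil v) /shift ren_wk.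
by move=> tu; rewrite (conv_eta t) (conv_eta u) !E tu; exact: conv_refl.
Qed.

Lemma conv_fun2 A B C (t u : tm [::] (Arrow A (Arrow B C))) :
  conv (tapp (tapp (wk [:: B; A] t) (tvar (vs vz))) (tvar vz))
       (tapp (tapp (wk [:: B; A] u) (tvar (vs vz))) (tvar vz)) ->
  conv t u.
Proof.
move=> tu; apply: conv_fun.
rewrite (conv_eta (tapp (wk _ t) _)) (conv_eta (tapp (wk _ u) _)).
by rewrite /shift /= !ren_wk tu.
Qed.

Definition idt A : tm [::] (Arrow A A) := tlam (tvar vz).

Definition app A B (M : Tm (Arrow A B)) (P : Tm A) : Tm B :=
  cls (tapp (rep M) (rep P)).

Lemma app_cls A B (t : tm [::] (Arrow A B)) (u : tm [::] A) :
  app (cls t) (cls u) = cls (tapp t u).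
Proof. by apply/cls_eq; rewrite !rep_cls; exact: conv_refl. Qed.

Definition Lam_comp A B C (N : Tm (Arrow B C)) (M : Tm (Arrow A B)) :
    Tm (Arrow A C) := cls (compt (rep N) (rep M)).

Lemma Lam_comp_cls A B C (u : tm [::] (Arrow B C)) (t : tm [::] (Arrow A B)) :
  Lam_comp (cls u) (cls t) = cls (compt u t).
Proof. by apply/cls_eq; rewrite !rep_cls; exact: conv_refl. Qed.

Definition Lam_id A : Tm (Arrow A A) := cls (idt A).

Lemma Lam_comp1l A B (M : Tm (Arrow A B)) : Lam_comp (Lam_id B) M = M.
Proof.
elim/clsP: M => t; rewrite Lam_comp_cls; apply/cls_eq/conv_fun.
by rewrite wk_compt wk_beta; exact: conv_refl.
Qed.

Lemma Lam_comp1r A B (M : Tm (Arrow A B)) : Lam_comp M (Lam_id A) = M.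
Proof.
elim/clsP: M => t; rewrite Lam_comp_cls; apply/cls_eq/conv_fun.
by rewrite wk_compt wk_beta; exact: conv_refl.
Qed.

Lemma Lam_compA A B C D (P : Tm (Arrow C D)) (N : Tm (Arrow B C))
    (M : Tm (Arrow A B)) :
  Lam_comp P (Lam_comp N M) = Lam_comp (Lam_comp P N) M.
Proof.
elim/clsP: P => v; elim/clsP: N => u; elim/clsP: M => t.
rewrite !Lam_comp_cls; apply/cls_eq/conv_fun.
by rewrite !wk_compt; exact: conv_refl.
Qed.

Definition Lam : category :=
  @Category ty (fun A B => Tm (Arrow A B)) Lam_id Lam_comp
    Lam_comp1l Lam_comp1r Lam_compA.

Definition bangt A : tm [::] (Arrow A One) := tlam tunit.
Definition proj1t A B : tm [::] (Arrow (Prod A B) A) := tlam (tfst (tvar vz)).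
Definition proj2t A B : tm [::] (Arrow (Prod A B) B) := tlam (tsnd (tvar vz)).

Definition pairt C A B (t : tm [::] (Arrow C A)) (u : tm [::] (Arrow C B)) :
    tm [::] (Arrow C (Prod A B)) :=
  tlam (tpair (tapp (wk [:: C] t) (tvar vz)) (tapp (wk [:: C] u) (tvar vz))).

Definition evalt A B : tm [::] (Arrow (Prod (Arrow A B) A) B) :=
  tlam (tapp (tfst (tvar vz)) (tsnd (tvar vz))).

Definition curryt C A B (t : tm [::] (Arrow (Prod C A) B)) :
    tm [::] (Arrow C (Arrow A B)) :=
  tlam (tlam (tapp (wk [:: A; C] t) (tpair (tvar (vs vz)) (tvar vz)))).

Definition Lam_bang A : Tm (Arrow A One) := cls (bangt A).
Definition Lam_proj1 A B : Tm (Arrow (Prod A B) A) := cls (proj1t A B).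
Definition Lam_proj2 A B : Tm (Arrow (Prod A B) B) := cls (proj2t A B).
Definition Lam_pair C A B (M : Tm (Arrow C A)) (N : Tm (Arrow C B)) :
    Tm (Arrow C (Prod A B)) := cls (pairt (rep M) (rep N)).
Definition Lam_eval A B : Tm (Arrow (Prod (Arrow A B) A) B) :=
  cls (evalt A B).
Definition Lam_curry C A B (M : Tm (Arrow (Prod C A) B)) :
    Tm (Arrow C (Arrow A B)) := cls (curryt (rep M)).

#[export] Instance pairt_proper C A B :
  Proper (@conv _ (Arrow C A) ==> @conv _ (Arrow C B) ==>
          @conv _ (Arrow C (Prod A B))) (@pairt C A B).
Proof. by move=> u u' uu' t t' tt'; rewrite /pairt uu' tt'. Qed.

#[export] Instance curryt_proper C A B :
  Proper (@conv _ (Arrow (Prod C A) B) ==> @conv _ (Arrow C (Arrow A B)))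
    (@curryt C A B).
Proof. by move=> u u' uu'; rewrite /curryt uu'. Qed.

Lemma Lam_pair_cls C A B (t : tm [::] (Arrow C A)) (u : tm [::] (Arrow C B)) :
  Lam_pair (cls t) (cls u) = cls (pairt t u).
Proof. by apply/cls_eq; rewrite !rep_cls; exact: conv_refl. Qed.

Lemma Lam_curry_cls C A B (t : tm [::] (Arrow (Prod C A) B)) :
  Lam_curry (cls t) = cls (curryt t).
Proof. by apply/cls_eq; rewrite !rep_cls; exact: conv_refl. Qed.

Lemma wk_pairt G C A B (t : tm [::] (Arrow C A)) (u : tm [::] (Arrow C B))
    (x : tm G C) :
  conv (tapp (wk G (pairt t u)) x) (tpair (tapp (wk G t) x) (tapp (wk G u) x)).
Proof. by rewrite wk_beta /= !sub_wk; exact: conv_refl. Qed.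

Lemma wk_curryt G C A B (t : tm [::] (Arrow (Prod C A) B)) (x : tm G C)
    (y : tm G A) :
  conv (tapp (tapp (wk G (curryt t)) x) y) (tapp (wk G t) (tpair x y)).
Proof.
rewrite wk_beta /= conv_beta /sub1 /= !sub_wk /shift /= /ups /= sub_ren.
by rewrite sub_id; exact: conv_refl.
Qed.

Lemma Lam_bang_uniq A (M : Tm (Arrow A One)) : M = Lam_bang A.
Proof.
elim/clsP: M => t; apply/cls_eq/conv_fun.
by rewrite (conv_eta_unit (tapp _ _)) wk_beta; exact: conv_refl.
Qed.

Lemma Lam_pair1 C A B (M : Tm (Arrow C A)) (N : Tm (Arrow C B)) :
  Lam_comp (Lam_proj1 A B) (Lam_pair M N) = M.
Proof.
elim/clsP: M => t; elim/clsP: N => u; rewrite Lam_pair_cls Lam_comp_cls.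
apply/cls_eq/conv_fun; rewrite wk_compt wk_beta /= wk_pairt conv_beta_fst.
exact: conv_refl.
Qed.

Lemma Lam_pair2 C A B (M : Tm (Arrow C A)) (N : Tm (Arrow C B)) :
  Lam_comp (Lam_proj2 A B) (Lam_pair M N) = N.
Proof.
elim/clsP: M => t; elim/clsP: N => u; rewrite Lam_pair_cls Lam_comp_cls.
apply/cls_eq/conv_fun; rewrite wk_compt wk_beta /= wk_pairt conv_beta_snd.
exact: conv_refl.
Qed.

Lemma Lam_pair_uniq C A B (M : Tm (Arrow C (Prod A B))) :
  M = Lam_pair (Lam_comp (Lam_proj1 A B) M) (Lam_comp (Lam_proj2 A B) M).
Proof.
elim/clsP: M => t; rewrite !Lam_comp_cls Lam_pair_cls.
apply/cls_eq/conv_fun; rewrite wk_pairt !wk_compt !wk_beta /=.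
exact: conv_eta_pair.
Qed.

Lemma Lam_curryK C A B (M : Tm (Arrow (Prod C A) B)) :
  Lam_comp (Lam_eval A B)
    (Lam_pair (Lam_comp (Lam_curry M) (Lam_proj1 C A)) (Lam_proj2 C A)) = M.
Proof.
elim/clsP: M => t; rewrite Lam_curry_cls (Lam_comp_cls (curryt t)).
rewrite Lam_pair_cls Lam_comp_cls.
apply/cls_eq/conv_fun; rewrite wk_compt wk_beta /= wk_pairt.
rewrite conv_beta_fst conv_beta_snd wk_compt wk_curryt !wk_beta /=.
by rewrite -conv_eta_pair; exact: conv_refl.
Qed.

Lemma Lam_curry_uniq C A B (M : Tm (Arrow C (Arrow A B))) :
  M = Lam_curry (Lam_comp (Lam_eval A B)
        (Lam_pair (Lam_comp M (Lam_proj1 C A)) (Lam_proj2 C A))).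
Proof.
elim/clsP: M => t; rewrite (Lam_comp_cls t) Lam_pair_cls Lam_comp_cls.
rewrite Lam_curry_cls.
apply/cls_eq/conv_fun2; rewrite wk_curryt wk_compt wk_beta /= wk_pairt.
rewrite conv_beta_fst conv_beta_snd wk_compt !wk_beta /=.
by rewrite conv_beta_fst conv_beta_snd; exact: conv_refl.
Qed.

Definition Lam_cc : cartesian_closed Lam :=
  @CartesianClosed Lam One Lam_bang Lam_bang_uniq
    Prod Lam_proj1 Lam_proj2 Lam_pair Lam_pair1 Lam_pair2 Lam_pair_uniq
    Arrow Lam_eval Lam_curry Lam_curryK Lam_curry_uniq.

Section Semantics.
Variable Q : finType.

Fixpoint sem (A : ty) : finType :=
  match A with
  | Prod A B => (sem A * sem B)%type
  | Arrow A B => {ffun sem A -> sem B}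
  | One => unit
  | Base => Q
  end.

Definition env (G : seq ty) := forall A, var G A -> sem A.

Fixpoint sem_tm G A (t : tm G A) : env G -> sem A :=
  match t in tm _ A return env G -> sem A with
  | tvar _ v => fun e => e _ v
  | tlam A B t => fun e =>
      [ffun x : sem A => sem_tm t (scons (T := fun A => sem A) x e)]
  | tapp A B t u => fun e => (sem_tm t e : {ffun sem A -> sem B}) (sem_tm u e)
  | tpair _ _ t u => fun e => (sem_tm t e, sem_tm u e)
  | tfst A B t => fun e => (sem_tm t e : sem A * sem B).1
  | tsnd A B t => fun e => (sem_tm t e : sem A * sem B).2
  | tunit => fun e => tt
  end.

Lemma sem_ext G A (t : tm G A) (e e' : env G) :
  (forall A v, e A v = e' A v) -> sem_tm t e = sem_tm t e'.
Proof.
elim: t e e' => {G A} [G A v|G A B t IH|G A B t IH u IHu|G A B t IH u IHu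
  |G A B t IH|G A B t IH|G] e e' ee' //=; rewrite ?(IH _ e') ?(IHu _ e') //.
by apply/ffunP => x; rewrite !ffunE; apply: IH; apply: var_cons.
Qed.

Lemma sem_ren G A (t : tm G A) D (r : vren G D) (e : env D) :
  sem_tm (ren t r) e = sem_tm t (fun A v => e A (r A v)).
Proof.
elim: t D r e => {G A} [G A v|G A B t IH|G A B t IH u IHu|G A B t IH u IHu
  |G A B t IH|G A B t IH|G] D r e //=; rewrite ?IH ?IHu //.
apply/ffunP => x; rewrite !ffunE IH; apply: sem_ext; exact: var_cons.
Qed.

Lemma sem_sub G A (t : tm G A) D (s : vsub G D) (e : env D) :
  sem_tm (sub t s) e = sem_tm t (fun A v => sem_tm (s A v) e).
Proof.
elim: t D s e => {G A} [G A v|G A B t IH|G A B t IH u IHu|G A B t IH u IHu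
  |G A B t IH|G A B t IH|G] D s e //=; rewrite ?IH ?IHu //.
apply/ffunP => x; rewrite !ffunE IH; apply: sem_ext; apply: var_cons => //= C v.
by rewrite /ups /= /shift sem_ren.
Qed.

Lemma sem_conv G A (t u : tm G A) (e : env G) :
  conv t u -> sem_tm t e = sem_tm u e.
Proof.
move=> tu; elim: tu e => {G A t u} //=.
- by move=> G A t u v _ IH1 _ IH2 e; rewrite IH1.
- by move=> G A B t t' _ IH e; apply/ffunP => x; rewrite !ffunE.
- by move=> G A B t t' u u' _ IH1 _ IH2 e; rewrite IH1 IH2.
- by move=> G A B t t' u u' _ IH1 _ IH2 e; rewrite IH1 IH2.
- by move=> G A B t t' _ IH e; rewrite IH.
- by move=> G A B t t' _ IH e; rewrite IH.
- move=> G A B t u e; rewrite ffunE /sub1 sem_sub.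
  apply: sem_ext; exact: var_cons.
- move=> G A B t e; apply/ffunP => x; rewrite ffunE /shift sem_ren.
  by congr (fun_of_fin _ _); apply: sem_ext.
- by move=> G A B t e; case: (sem_tm t e).
- by move=> G t e; case: (sem_tm t e).
Qed.

(* Independent of the representative: see [sem_conv] and [sem_Tm_cls]. *)
Definition sem_Tm A (M : Tm A) : sem A := sem_tm (rep M) (@vnil (fun A => sem A)).

Lemma sem_Tm_cls A (t : tm [::] A) :
  sem_Tm (cls t) = sem_tm t (@vnil (fun A => sem A)).
Proof. exact/sem_conv/rep_cls. Qed.

Definition Q_regular A (L : set (Tm A)) :=
  exists F : {set sem A}, L = [set M | sem_Tm M \in F].

End Semantics.

Definition regular A (L : set (Tm A)) := exists Q : finType, Q_regular Q L.

Record Reg_obj := RegObj {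
  carrier : ty;
  lang : set (Tm carrier);
  lang_regular : regular lang }.

Arguments lang : clear implicits.

Definition Reg_hom (X Y : Reg_obj) :=
  {M : Tm (Arrow (carrier X) (carrier Y)) |
    forall P, lang X P -> lang Y (app M P)}.

Lemma app_id A (P : Tm A) : app (Lam_id A) P = P.
Proof. elim/clsP: P => t; rewrite app_cls; exact/cls_eq/conv_beta. Qed.

Lemma app_comp A B C (N : Tm (Arrow B C)) (M : Tm (Arrow A B)) (P : Tm A) :
  app (Lam_comp N M) P = app N (app M P).
Proof.
elim/clsP: P => t; elim/clsP: N => u; elim/clsP: M => v.
by rewrite Lam_comp_cls !app_cls; exact/cls_eq/compt_app.
Qed.

Lemma Reg_hom_eq X Y (f g : Reg_hom X Y) : sval f = sval g -> f = g.
Proof.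
case: f g => [M MP] [N NP] /= MN; case: N / MN NP => NP.
by congr exist; exact: Prop_irrelevance.
Qed.

Definition Reg_id (X : Reg_obj) : Reg_hom X X.
Proof. by exists (Lam_id _) => P; rewrite app_id. Defined.

Definition Reg_comp X Y Z (g : Reg_hom Y Z) (f : Reg_hom X Y) : Reg_hom X Z.
Proof.
exists (Lam_comp (sval g) (sval f)) => P XP; rewrite app_comp.
exact/(svalP g)/(svalP f).
Defined.

Lemma Reg_comp1l X Y (f : Reg_hom X Y) : Reg_comp (Reg_id Y) f = f.
Proof. exact/Reg_hom_eq/Lam_comp1l. Qed.

Lemma Reg_comp1r X Y (f : Reg_hom X Y) : Reg_comp f (Reg_id X) = f.
Proof. exact/Reg_hom_eq/Lam_comp1r. Qed.

Lemma Reg_compA X Y Z W (h : Reg_hom Z W) (g : Reg_hom Y Z) (f : Reg_hom X Y) :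
  Reg_comp h (Reg_comp g f) = Reg_comp (Reg_comp h g) f.
Proof. exact/Reg_hom_eq/Lam_compA. Qed.

Definition Reg : category :=
  @Category Reg_obj Reg_hom Reg_id Reg_comp Reg_comp1l Reg_comp1r Reg_compA.

Definition forget : functor Reg Lam :=
  @Functor Reg Lam carrier (fun X Y (f : Reg_hom X Y) => sval f)
    (fun X => erefl) (fun X Y Z g f => erefl).

(* Main.v *)
(** All the closure properties of regular languages are immediate once the
    languages involved are recognized by the same finite set [Q]; in
    particular, a language of functions [M] sending [LA] into [LB] is recognized
    by the set of the [f] that send the denotations of the elements of [LA] into
    the accepting set of [LB]. A common [Q] is obtained from an injection
    [i : Q -> Q'] with [Q'] inhabited: the logical relation that is the converse
    graph of [i] on the base type is a surjective partial function from the
    [Q']-semantics to the [Q]-semantics at every type, so the [Q']-denotation of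
    a closed term determines its [Q]-denotation. *)
From mathcomp Require Import all_boot.
From mathcomp Require Import boolp classical_sets.
Require Import Defs.

Set Implicit Arguments.
Unset Strict Implicit.
Unset Printing Implicit Defensive.

Local Open Scope classical_set_scope.

Lemma app_proj1_pair C A B (M : Tm (Arrow C A)) (N : Tm (Arrow C B)) P :
  app (Lam_proj1 A B) (app (Lam_pair M N) P) = app M P.
Proof. by rewrite -app_comp Lam_pair1. Qed.

Lemma app_proj2_pair C A B (M : Tm (Arrow C A)) (N : Tm (Arrow C B)) P :
  app (Lam_proj2 A B) (app (Lam_pair M N) P) = app N P.
Proof. by rewrite -app_comp Lam_pair2. Qed.

(** Both sides reduce by beta to the first component of [P] applied to the second. *)
Lemma app_eval A B (P : Tm (Prod (Arrow A B) A)) :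
  app (Lam_eval A B) P = app (app (Lam_proj1 _ _) P) (app (Lam_proj2 _ _) P).
Proof.
elim/clsP: P => t; rewrite /Lam_eval /Lam_proj1 /Lam_proj2 !app_cls.
apply/cls_eq.
rewrite /evalt /proj1t /proj2t !conv_beta /sub1 /=.
exact: conv_refl.
Qed.

Definition pair_Tm A B (P : Tm A) (N : Tm B) : Tm (Prod A B) :=
  cls (tpair (rep P) (rep N)).

Lemma app_proj1 A B (P : Tm A) (N : Tm B) :
  app (Lam_proj1 A B) (pair_Tm P N) = P.
Proof.
rewrite app_cls -[RHS]repK; apply/cls_eq.
by rewrite conv_beta /sub1 /= conv_beta_fst; exact: conv_refl.
Qed.

Lemma app_proj2 A B (P : Tm A) (N : Tm B) :
  app (Lam_proj2 A B) (pair_Tm P N) = N.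
Proof.
rewrite app_cls -[RHS]repK; apply/cls_eq.
by rewrite conv_beta /sub1 /= conv_beta_snd; exact: conv_refl.
Qed.

Lemma app_curry C A B (M : Tm (Arrow (Prod C A) B)) (P : Tm C) (N : Tm A) :
  app (app (Lam_curry M) P) N = app M (pair_Tm P N).
Proof.
elim/clsP: M => t; rewrite Lam_curry_cls -(repK P) -(repK N) !app_cls.
apply/cls_eq; have := wk_curryt t (rep P) (rep N).
by rewrite !wk_nil !rep_cls.
Qed.

Lemma sem_app (Q : finType) A B (M : Tm (Arrow A B)) (P : Tm A) :
  sem_Tm Q (app M P) = (sem_Tm Q M : {ffun _ -> _}) (sem_Tm Q P).
Proof. by elim/clsP: P => u; elim/clsP: M => t; rewrite app_cls !sem_Tm_cls. Qed.

(** * Transfer of recognition along an injection of base sets *)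

Section ChangeOfBase.
Variables (Q Q' : finType) (q0 : Q') (i : Q -> Q').
Hypothesis i_inj : injective i.

Fixpoint lrel A : sem Q' A -> sem Q A -> Prop :=
  match A return sem Q' A -> sem Q A -> Prop with
  | Prod A B => fun x y => lrel x.1 y.1 /\ lrel x.2 y.2
  | Arrow A B => fun f g => forall x y, lrel x y -> lrel (f x) (g y)
  | One => fun _ _ => True
  | Base => fun x y => x = i y
  end.

(** Default values for functions at arguments related to nothing; [q0] provides them at the base
    type. *)
Fixpoint sem_point A : sem Q' A :=
  match A with
  | Prod A B => (sem_point A, sem_point B)
  | Arrow A B => [ffun=> sem_point B]
  | One => tt
  | Base => q0
  end.

(* The two properties need each other at arrow types: functionality on the
   codomain uses surjectivity on the domain, and conversely. *)
Lemma lrel_functional_surjective A :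
  (forall (x : sem Q' A) y y', lrel x y -> lrel x y' -> y = y') /\
  (forall y : sem Q A, exists x : sem Q' A, lrel x y).
Proof.
elim: A => [A [fA sA] B [fB sB]|A [fA sA] B [fB sB]||] /=.
- split=> [[x1 x2] [y1 y2] [z1 z2] /= [r1 r2] [s1 s2]|[y1 y2]].
    by rewrite (fA _ _ _ r1 s1) (fB _ _ _ r2 s2).
  have [x1 r1] := sA y1; have [x2 r2] := sB y2.
  by exists (x1, x2).
- split=> [f g g' fg fg'|g].
    apply/ffunP => a; have [x xa] := sA a.
    exact: fB (fg _ _ xa) (fg' _ _ xa).
  (* By functionality at [A], at most one [a] is related to [x], so a single [z] related to [g a]
     suffices; if there is none, any value works. *)
  have /choice[h hP] : forall x : sem Q' A, exists z : sem Q' B,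
      forall a, lrel x a -> lrel z (g a).
    move=> x; have [[a xa]|nx] := pselect (exists a, lrel x a); last first.
      by exists (sem_point B) => a xa; case: nx; exists a.
    have [z za] := sB (g a); exists z => b xb.
    by rewrite -(fA _ _ _ xa xb).
  by exists [ffun x => h x] => x a xa; rewrite ffunE; apply: hP.
- by split=> [_ [] []|] //; exists tt.
- by split=> [x y y' -> /i_inj|y] //; exists (i y).
Qed.

(** The fundamental lemma of logical relations, by induction on the term. *)
Lemma lrel_sem_tm G A (t : tm G A) (e : env Q' G) (e' : env Q G) :
  (forall B v, lrel (e B v) (e' B v)) -> lrel (sem_tm t e) (sem_tm t e').
Proof.
elim: t e e' => {G A} [G A v|G A B t IH|G A B t IH u IHu|G A B t IH u IHu
  |G A B t IH|G A B t IH|G] e e' ee' //=.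
- by move=> x y xy; rewrite !ffunE; apply: IH; apply: var_cons.
- by apply: (IH _ _ ee'); apply: IHu.
- by split; [apply: IH | apply: IHu].
- by have [] := IH _ _ ee'.
- by have [] := IH _ _ ee'.
Qed.

Lemma Q_regular_inj A (L : set (Tm A)) : Q_regular Q L -> Q_regular Q' L.
Proof.
(* The new accepting set is the preimage of [F] under the partial function [lrel]. *)
move=> [F ->]; exists [set x | `[< exists2 y, lrel x y & y \in F >]]%SET.
apply/seteqP; split=> M /=; rewrite inE.
  move=> MF; apply/asboolP; exists (sem_Tm Q M) => //.
  by apply: lrel_sem_tm; apply: var_nil.
move=> /asboolP[y My yF].
have MM : lrel (sem_Tm Q' M) (sem_Tm Q M).
  by apply: lrel_sem_tm; apply: var_nil.
by rewrite ((lrel_functional_surjective A).1 _ _ _ MM My).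
Qed.

End ChangeOfBase.

(** * Closure properties of regular languages *)

Lemma regular_common A B (L : set (Tm A)) (K : set (Tm B)) :
  regular L -> regular K -> exists Q, Q_regular Q L /\ Q_regular Q K.
Proof.
(* [None] is the required inhabitant even when [Q1] and [Q2] are both empty. *)
move=> [Q1 L1] [Q2 K2]; exists (option (Q1 + Q2)%type); split.
- by apply: (@Q_regular_inj _ _ None (Some \o inl)) L1 => x y [].
- by apply: (@Q_regular_inj _ _ None (Some \o inr)) K2 => x y [].
Qed.

Lemma regularT A : regular [set: Tm A].
Proof. by exists unit, [set: _]%SET; apply/seteqP; split=> M //=; rewrite inE. Qed.

Lemma regularI A (L K : set (Tm A)) :
  regular L -> regular K -> regular (L `&` K).
Proof.
move=> rL rK; have [Q [[F ->] [F' ->]]] := regular_common rL rK.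
by exists Q, (F :&: F'); apply/seteqP; split=> M /=; rewrite inE => /andP.
Qed.

Lemma regular_preimage A B (M : Tm (Arrow A B)) (L : set (Tm B)) :
  regular L -> regular [set P | L (app M P)].
Proof.
move=> [Q [F ->]]; exists Q, [set x | (sem_Tm Q M : {ffun _ -> _}) x \in F]%SET.
by apply/seteqP; split=> P /=; rewrite inE sem_app.
Qed.

Lemma regular_arrow A B (L : set (Tm A)) (K : set (Tm B)) :
  regular L -> regular K ->
  regular [set M : Tm (Arrow A B) | forall P, L P -> K (app M P)].
Proof.
move=> rL rK; have [Q [_ [F ->]]] := regular_common rL rK.
exists Q, [set f : {ffun sem Q A -> sem Q B} |
  `[< forall P, L P -> f (sem_Tm Q P) \in F >]]%SET.
apply/seteqP; split=> M /=; rewrite inE.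
  by move=> MK; apply/asboolP => P /MK; rewrite sem_app.
by move=> /asboolP MK P /MK; rewrite sem_app.
Qed.

(** * Cartesian closed structure and fibration *)

Definition Reg_unit : Reg := RegObj (regularT One).

Definition Reg_prod (X Y : Reg) : Reg :=
  RegObj (regularI
    (regular_preimage (Lam_proj1 (carrier X) (carrier Y)) (lang_regular X))
    (regular_preimage (Lam_proj2 (carrier X) (carrier Y)) (lang_regular Y))).

Definition Reg_expo (X Y : Reg) : Reg :=
  RegObj (regular_arrow (lang_regular X) (lang_regular Y)).

Definition Reg_bang (X : Reg) : Reg_hom X Reg_unit :=
  exist _ (Lam_bang (carrier X)) (fun P _ => I).

Definition Reg_proj1 (X Y : Reg) : Reg_hom (Reg_prod X Y) X.
Proof. by exists (Lam_proj1 (carrier X) (carrier Y)) => P []. Defined.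

Definition Reg_proj2 (X Y : Reg) : Reg_hom (Reg_prod X Y) Y.
Proof. by exists (Lam_proj2 (carrier X) (carrier Y)) => P []. Defined.

Definition Reg_pair (Z X Y : Reg) (f : Reg_hom Z X) (g : Reg_hom Z Y) :
  Reg_hom Z (Reg_prod X Y).
Proof.
exists (Lam_pair (sval f) (sval g)) => P ZP.
by split; rewrite /= ?app_proj1_pair ?app_proj2_pair;
  [exact: (svalP f) | exact: (svalP g)].
Defined.

Definition Reg_eval (X Y : Reg) : Reg_hom (Reg_prod (Reg_expo X Y) X) Y.
Proof.
exists (Lam_eval (carrier X) (carrier Y)) => P [P1 P2].
by rewrite app_eval; apply: P1.
Defined.

Definition Reg_curry (Z X Y : Reg) (f : Reg_hom (Reg_prod Z X) Y) :
  Reg_hom Z (Reg_expo X Y).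
Proof.
exists (Lam_curry (sval f)) => P ZP N XN; rewrite app_curry.
by apply: (svalP f); split; rewrite /= ?app_proj1 ?app_proj2.
Defined.

(** Since [forget] is faithful, every equation is inherited from [Lam]. *)
Definition Reg_cc : cartesian_closed Reg.
Proof.
refine (@CartesianClosed Reg Reg_unit Reg_bang _
  Reg_prod Reg_proj1 Reg_proj2 Reg_pair _ _ _ Reg_expo Reg_eval Reg_curry _ _).
- by move=> X f; apply: Reg_hom_eq; apply: Lam_bang_uniq.
- by move=> Z X Y f g; apply: Reg_hom_eq; apply: Lam_pair1.
- by move=> Z X Y f g; apply: Reg_hom_eq; apply: Lam_pair2.
- by move=> Z X Y h; apply: Reg_hom_eq; apply: Lam_pair_uniq.
- by move=> Z X Y f; apply: Reg_hom_eq; apply: Lam_curryK.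
- by move=> Z X Y g; apply: Reg_hom_eq; apply: Lam_curry_uniq.
Defined.

(** The cartesian lifting of [f] is [f] itself, with the preimage of the language of [V] as
    domain. *)
Lemma forget_fibration : fibration forget.
Proof.
move=> A B f V VB; case: B / VB f => f.
pose U : Reg := RegObj (regular_preimage f (lang_regular V)).
have fP P : lang U P -> lang V (app f P) by [].
pose g : Reg_hom U V := exist _ f fP.
exists U, g; split=> // W h w gw.
have wP P : lang W P -> lang U (app w P).
  by move=> WP; rewrite /= -app_comp [Lam_comp f w]gw; apply: (svalP h).
exists (exist _ w wP : Reg_hom W U); split.
  by split=> //; apply: Reg_hom_eq.
by move=> k [kw _]; apply: Reg_hom_eq.
Qed.

Theorem theorem4p7 :
  (exists KReg : cartesian_closed Reg,
     strictly_preserves_finite_products KReg Lam_cc forget /\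
     strictly_preserves_internal_homs KReg Lam_cc forget) /\
  fibration forget.
Proof.
(* Strict preservation holds by computation: [forget] sends the structure of [Reg_cc] to that of
   [Lam_cc] definitionally. *)
by split; [exists Reg_cc | exact: forget_fibration].
Qed.
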